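(* Let $(X,\mathcal X,\mu)$ be a probability space, let $f\in L^\infty(X,\mu)^+$ and let $w\ge\int_X f\,d\mu$. Let $c=c(w)\ge\operatorname{ess\,inf}f$ be the unique number with $\int_X f_c\,d\mu=w$, where $f_c=\max\{f,c\}$. Then for every $h\in L^\infty(X,\mu)^+$: if $f\le h$ and $\int_X h\,d\mu\ge w$, then $f_c\prec_w h$.
   Context: $L^\infty(X,\mu)^+=\{f\in L^\infty(X,\mu):f\ge0\}$ (inequalities a.e.). For $f\in L^\infty(X,\mu)^+$ the decreasing rearrangement $f^*:[0,1)\to[0,\infty)$ is $f^*(s)=\sup\{t\ge0:\mu\{x\in X:f(x)>t\}>s\}$ (with $\sup\emptyset=0$). For $f,g\in L^\infty(X,\mu)^+$, $g\prec_w f$ (''$f$ submajorizes $g$'') means $\int_0^s g^*(t)\,dt\le\int_0^s f^*(t)\,dt$ for every $0\le s\le1$. The function $c\mapsto\int_X\max\{f,c\}\,d\mu$ is continuous and strictly increasing on $[\operatorname{ess\,inf}f,\infty)$, with value $\int_X f\,d\mu$ at $\operatorname{ess\,inf}f$ and tending to $\infty$, so $c(w)$ exists and is unique. *)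

(* Defs.v *)
From mathcomp Require Import all_boot all_order all_algebra.
From mathcomp Require Import all_classical all_reals all_analysis.
From mathcomp Require Import ess_sup_inf hoelder.

Set Implicit Arguments.
Unset Strict Implicit.
Unset Printing Implicit Defensive.

Import Order.TTheory GRing.Theory Num.Theory.
Import numFieldNormedType.Exports.

Local Open Scope classical_set_scope.
Local Open Scope ring_scope.

Section Rearrangement.
Context {d : measure_display} {X : measurableType d} {R : realType}.
Variable mu : probability X R.

(* The positive cone of L^oo, by representatives: measurable, essentially
   bounded functions.  All the notions below only depend on the class of the
   functions modulo almost everywhere equality. *)
Definition Linfty_pos : set (X -> R) :=
  [set f | f \in Lfun mu +oo%E /\ \forall x \ae mu, 0 <= f x].

(* For s >= 0 and f essentially bounded, the set is bounded above, and
   sup set0 = 0 in the library, so this is the usual supremum, with value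
   0 for s >= 1.  The values at s < 0 are meaningless. *)
Definition decreasing_rearrangement (f : X -> R) (s : R) : R :=
  sup [set t : R | 0 <= t /\ (s%:E < mu [set x | (t < f x)%R])%E].

(* submajorizes f g is g <_w f *)
Definition submajorizes (f g : X -> R) : Prop :=
  forall s : R, 0 <= s <= 1 ->
    (\int[lebesgue_measure]_(t in `[0%R, s]) (decreasing_rearrangement g t)%:E
     <= \int[lebesgue_measure]_(t in `[0%R, s])
          (decreasing_rearrangement f t)%:E)%E.

Definition truncation_level (f : X -> R) (w c : R) : Prop :=
  (ess_inf mu (EFin \o f) <= c%:E)%E /\
  (\int[mu]_x ((f \max cst c) x)%:E = w%:E)%E.

End Rearrangement.

(* Main.v *)
(* On [0, 1[ the rearrangement of max(f, c) is max(f^*, c), and f^* <= h^*.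
   Fix s. If h^*(s) >= c, then h^* >= max(f^*, c) on [0, s] by monotonicity.
   If h^*(s) < c, then h^* <= c <= max(f^*, c) on ]s, 1], so the inequality on
   [0, s] follows by subtracting from the total integrals, which are those of h
   and of max(f, c) because rearranging preserves the integral. *)

Require Import Defs.
From mathcomp Require Import all_boot all_order all_algebra.
From mathcomp Require Import all_classical all_reals all_analysis.
From mathcomp Require Import ess_sup_inf measurable_realfun.
From mathcomp Require Import lra.

Set Implicit Arguments.
Unset Strict Implicit.
Unset Printing Implicit Defensive.

Import Order.TTheory GRing.Theory Num.Theory.
Import numFieldNormedType.Exports.

Local Open Scope classical_set_scope.
Local Open Scope ring_scope.

(** * Suprema of sets of nonnegative reals, where the convention [sup set0 = 0] is harmless *)

Section sup_nonneg.
Context {R : realType}.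
Implicit Types A B : set R.

Lemma sup_ge0 A : (forall t, A t -> 0 <= t) -> 0 <= sup A.
Proof.
move=> A0; have [supA|/sup_out ->//] := pselect (has_sup A).
have [[t At] ubA] := supA.
by rewrite (le_trans (A0 _ At))//; exact: ub_le_sup.
Qed.

Lemma ge_sup_ge0 A b : 0 <= b -> ubound A b -> sup A <= b.
Proof.
move=> b0 ubA; have [->|/set0P A0] := eqVneq A set0; first by rewrite sup0.
exact: ge_sup.
Qed.

Lemma le_sup_ge0 A B : A `<=` B -> (forall t, B t -> 0 <= t) -> has_ubound B ->
  sup A <= sup B.
Proof.
move=> AB B0 ubB; have [->|/set0P A0] := eqVneq A set0.
  by rewrite sup0; exact: sup_ge0.
by apply: ge_sup => // t /AB; exact: ub_le_sup.
Qed.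

(** Such a set is squeezed between [[0, sup A[] and [[0, sup A]], which have the same length. It is
    used to read a value of the rearrangement as the length of a section. *)
Lemma lebesgue_measure_initial_segment A : (forall t, A t -> 0 <= t) ->
  (forall t u, A t -> 0 <= u <= t -> A u) -> has_ubound A ->
  lebesgue_measure A = (sup A)%:E.
Proof.
move=> A0 dA ubA.
have mA : measurable A.
  apply: is_interval_measurable => t u At Au v /andP[tv vu].
  by apply: (dA u) => //; rewrite vu (le_trans (A0 _ At)).
have s0 := sup_ge0 A0.
have Ls b : lebesgue_measure [set` Interval (BLeft 0) (BSide b (sup A))] =
    (sup A)%:E.
  rewrite lebesgue_measure_itv/= lte_fin oppr0 adde0.
  by case: ltgtP s0 => // <-.
apply/eqP; rewrite eq_le; apply/andP; split.
  rewrite -(Ls false); apply: le_measure; rewrite ?inE//= => t At.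
  by rewrite /= in_itv/= A0//=; exact: ub_le_sup.
rewrite -{1}(Ls true); apply: le_measure; rewrite ?inE//= => t.
rewrite /= in_itv/= => /andP[t0 tA].
have [u Au tu] : exists2 u, A u & t < u.
  apply: sup_gt => //; apply/set0P/eqP => A_0.
  by move: tA; rewrite A_0 sup0 ltNge t0.
by apply: (dA u) => //; rewrite t0 ltW.
Qed.

End sup_nonneg.

(** * The positive cone and the decreasing rearrangement *)

Section rearrangement.
Context {d : measure_display} {X : measurableType d} {R : realType}.
Variable mu : probability X R.
Implicit Types f g : X -> R.

(** Since [f] is nonnegative a.e., bounding its essential norm amounts to bounding [f] itself from
    above a.e. *)
Lemma Linfty_posP f : Linfty_pos mu f <->
  [/\ measurable_fun setT f, (exists M, \forall x \ae mu, f x <= M) &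
      \forall x \ae mu, 0 <= f x].
Proof.
split=> [[/andP[]]|[mf [M fM] f0]].
  rewrite !inE /= /finite_norm unlock /= probability_setT lte01 => mf.
  move=> /ess_supr_bounded[M fM] f0; split=> //; exists M.
  by apply: filterS fM => x; apply: le_trans; exact: ler_norm.
split=> //; apply/andP; split; rewrite !inE//=.
rewrite /finite_norm unlock /= probability_setT lte01.
apply: (@le_lt_trans _ _ M%:E); last exact: ltry.
by apply/ess_supP; apply: filterS2 fM f0 => x fM f0 /=; rewrite lee_fin ger0_norm.
Qed.

Lemma measurable_gt f (t : R) : measurable_fun setT f ->
  measurable [set x | t < f x].
Proof.
move=> mf; rewrite -[X in measurable X]setTI -preimage_itvoy.
by apply: mf => //; exact: measurable_itv.
Qed.

(** The left superlevel set lies in the union of the right one and a null set. *)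
Lemma le_measure_gt f g (t : R) : measurable_fun setT f -> measurable_fun setT g ->
  (\forall x \ae mu, f x <= g x) ->
  (mu [set x | (t < f x)%R] <= mu [set x | (t < g x)%R])%E.
Proof.
move=> mf mg [N [mN N0 fgN]].
rewrite -[leRHS]adde0 -N0.
apply: le_trans (measureU2 _ (measurable_gt _ mg) mN).
apply: le_measure; rewrite ?inE; [exact: measurable_gt| |].
  by apply: measurableU => //; exact: measurable_gt.
move=> x /= tf; have [gt|tg] := leP (g x) t; last by left.
by right; apply: fgN => /= fg; move: tf; rewrite ltNge (le_trans fg).
Qed.

Lemma has_ubound_rearrangement f s : Linfty_pos mu f -> 0 <= s ->
  has_ubound [set t : R | 0 <= t /\ (s%:E < mu [set x | (t < f x)%R])%E].
Proof.
move=> /Linfty_posP[mf [M fM] f0] s0; exists M => t [t0].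
rewrite leNgt => st; apply/negP => Mt; move: st; apply/negP; rewrite -leNgt.
apply: (@le_trans _ _ 0%E); last by rewrite lee_fin.
(* The empty set is written as a superlevel set of the constant [t], which dominates [f] a.e.
   because [M < t]. *)
rewrite -(@measure0 _ _ _ mu) (_ : set0 = [set x : X | t < t])%R.
  apply: (@le_measure_gt f (cst t)) => //.
  by apply: filterS fM => x /le_trans; apply; exact: ltW.
by apply/seteqP; split=> x //=; rewrite ltxx.
Qed.

Local Notation "f ^#" := (decreasing_rearrangement mu f) (at level 2).

Lemma rearrangement_ge0 f s : 0 <= f^# s.
Proof. by apply: sup_ge0 => t []. Qed.

(** No set has probability above 1, so the supremum is over the empty set. This settles the endpoint
    1 of the closed intervals of integration, where [rearrangement_max] does not apply. *)
Lemma rearrangement_ge1 f s : measurable_fun setT f -> 1 <= s -> f^# s = 0.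
Proof.
move=> mf s1; rewrite /decreasing_rearrangement (_ : [set _ | _] = set0) ?sup0//.
rewrite -subset0 => t [_]; rewrite ltNge => /negP; apply.
apply: (@le_trans _ _ 1%E); last by rewrite lee_fin.
by apply: probability_le1; exact: measurable_gt.
Qed.

Lemma le_rearrangement f g s : Linfty_pos mu f -> Linfty_pos mu g ->
  (\forall x \ae mu, f x <= g x) -> 0 <= s -> f^# s <= g^# s.
Proof.
move=> /Linfty_posP[mf _ _] Lg fg s0; have /Linfty_posP[mg _ _] := Lg.
apply: le_sup_ge0 => [t [t0 st]|t []//|]; last exact: has_ubound_rearrangement.
by split=> //; apply: lt_le_trans st _; exact: le_measure_gt.
Qed.

Lemma rearrangement_nonincreasing f s t : Linfty_pos mu f -> 0 <= s -> s <= t ->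
  f^# t <= f^# s.
Proof.
move=> Lf s0 st.
apply: le_sup_ge0 => [u [u0 tu]|u []//|]; last exact: has_ubound_rearrangement.
by split=> //; apply: le_lt_trans tu; rewrite lee_fin.
Qed.

Lemma measurable_rearrangement f (D : set R) : Linfty_pos mu f ->
  measurable D -> (forall s, D s -> 0 <= s) -> measurable_fun D f^#.
Proof.
move=> Lf mD D0.
(* For negative [s] the defining set is unbounded and [sup] defaults to 0, which can break
   monotonicity; clamping the argument at 0 restores it on the whole line. *)
apply: (@eq_measurable_fun _ _ _ _ D (fun s => f^# (Num.max s 0))).
  by move=> s; rewrite inE => /D0 s0; rewrite max_l.
apply: nonincreasing_measurable => // s t st.
apply: rearrangement_nonincreasing => //; first by rewrite le_max lexx orbT.
by rewrite ge_max !le_max st lexx orbT.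
Qed.

Lemma Linfty_pos_max f c : Linfty_pos mu f -> Linfty_pos mu (f \max cst c).
Proof.
move=> /Linfty_posP[mf [M fM] f0]; apply/Linfty_posP; split.
- exact: measurable_maxr.
- exists (Num.max M c); apply: filterS fM => x fM /=.
  by rewrite ge_max !le_max fM lexx orbT.
- by apply: filterS f0 => x f0 /=; rewrite le_max f0.
Qed.

(** Truncation leaves the superlevel sets at levels [t >= c] unchanged and turns those at levels
    [t < c] into the whole space, of measure [1 > s]. *)
Lemma rearrangement_max f c s : Linfty_pos mu f -> 0 <= c -> 0 <= s < 1 ->
  (f \max cst c)^# s = Num.max (f^# s) c.
Proof.
move=> Lf c0 /andP[s0 s1]; have Lfc := Linfty_pos_max c Lf.
have ubf := has_ubound_rearrangement Lf s0.
have ubfc := has_ubound_rearrangement Lfc s0.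
apply/eqP; rewrite eq_le ge_max; apply/and3P; split.
- apply: ge_sup_ge0 => [|t [t0 st]]; first by rewrite le_max c0 orbT.
  rewrite le_max; have [//|ct] := leP t c; first by rewrite orbT.
  rewrite orbF; apply: ub_le_sup => //; split=> //.
  rewrite (_ : [set x | _] = [set x | t < (f \max cst c) x])//.
  by apply/seteqP; split=> x /=; rewrite lt_max (ltNge t c) (ltW ct) orbF.
- apply: le_rearrangement => //; apply: aeW => x /=.
  by rewrite le_max lexx.
- rewrite leNgt; apply/negP => lt_c.
  set r := _^# _ in lt_c.
  have r0 : 0 <= r by exact: rearrangement_ge0.
  (* If [r < c], the midpoint is a level below [c], hence admissible in the supremum [r], yet it
     exceeds [r]. *)
  have : (r + c) / 2 <= r; last lra.
  apply: ub_le_sup => //; split; first lra.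
  rewrite (_ : [set x | _] = setT) ?probability_setT ?lte_fin//.
  apply/seteqP; split=> // x _ /=; rewrite lt_max; apply/orP; right; lra.
Qed.

(* Fubini on the region A = {(s, t) : 0 <= s, 0 <= t, s < mu {f > t}}: its
   section at s has length f^# s (and is empty for s >= 1), its section at t
   has length mu {f > t}. *)
Lemma integral_rearrangement f : Linfty_pos mu f ->
  (\int[lebesgue_measure]_(s in `[0%R, 1%R]) (f^# s)%:E =
   \int[mu]_x (f x)%:E)%E.
Proof.
move=> Lf; have /Linfty_posP[mf _ f0] := Lf.
(* The tail formula for expectations asks for nonnegativity everywhere; this changes [f] only on a
   null set. *)
have mg : measurable_fun setT (f \max cst 0) by exact: measurable_maxr.
pose g : {RV mu >-> R} := mfun_Sub (mem_set mg).
pose G t := fine (ccdf g t).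
have EG t : (G t)%:E = ccdf g t by rewrite fineK// fin_num_measure.
pose RR := (measurableTypeR R * measurableTypeR R)%type.
pose b (p : RR) := [&& 0 <= p.1, 0 <= p.2 & p.1 < G p.2].
have mA : measurable (b @^-1` [set true]).
  have mG : measurable_fun setT (fun p : RR => G p.2).
    apply: (@measurableT_comp _ _ _ _ _ _ G) => //.
    by apply: measurableT_comp => //; exact: ccdf_measurable.
  have mb : measurable_fun setT b.
    have m1 : measurable_fun setT (fun p : RR => 0 <= p.1).
      exact: measurable_fun_ler (measurable_cst _) measurable_fst.
    have m2 : measurable_fun setT (fun p : RR => 0 <= p.2).
      exact: measurable_fun_ler (measurable_cst _) measurable_snd.
    have m3 : measurable_fun setT (fun p : RR => p.1 < G p.2).
      exact: measurable_fun_ltr measurable_fst mG.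
    exact: measurable_and m1 (measurable_and m2 m3).
  by rewrite -[X in measurable X]setTI; exact: mb.
set A := b @^-1` _ in mA.
have ccdfE t : 0 <= t -> ccdf g t = mu [set x | t < f x].
  move=> t0; rewrite /ccdf /distribution /pushforward; congr (mu _).
  by apply/seteqP; split=> x; rewrite /= in_itv/= andbT lt_max (ltNge t 0) t0 orbF.
transitivity (\int[mu]_x (g x)%:E)%E; last first.
  apply: ae_eq_integral => //.
  - exact/measurable_EFinP.
  - exact/measurable_EFinP.
  - by apply: filterS f0 => x f0 _ /=; rewrite max_l.
transitivity ('E_mu[g])%E; last by rewrite unlock.
(* Layer cake: the expectation is the integral of the tail probability over [[0, +oo[]. *)
rewrite ge0_expectation_ccdf; last by move=> x /=; rewrite le_max lexx orbT.
transitivity (\int[lebesgue_measure]_s \int[lebesgue_measure]_t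
  (\1_A (s, t))%:E)%E; last first.
  rewrite (fubini_tonelli (fun p : RR => (\1_A p)%:E))//=; last first.
    by apply/measurable_EFinP/measurable_indic.
  rewrite [RHS]integral_mkcond; apply: eq_integral => t _.
  transitivity (lebesgue_measure (ysection A t)).
    rewrite -[ysection A t]setIT -integral_indic//; last exact: measurable_ysection.
    by apply: eq_integral => s _; rewrite !indicE mem_ysection.
  rewrite patchE; case: ifPn; rewrite ?notin_setE ?inE /= in_itv/= andbT.
    move=> t0; rewrite (_ : ysection A t = `[0, G t[%classic); last first.
      by apply/seteqP; split=> s; rewrite /ysection /A /b /= inE /= in_itv/= t0.
    rewrite lebesgue_measure_itv/= lte_fin oppr0 adde0 -EG.
    have : 0 <= G t by rewrite fine_ge0.
    by case: ltgtP => // <-.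
  move=> /negP; rewrite -ltNge => t0.
  rewrite (_ : ysection A t = set0) ?measure0//.
  by rewrite -subset0 => s; rewrite /ysection /A /b /= inE /= (leNgt 0 t) t0 andbF.
rewrite [LHS]integral_mkcond; apply: eq_integral => s _.
transitivity (lebesgue_measure (xsection A s)); last first.
  rewrite -[xsection A s]setIT -integral_indic//; last exact: measurable_xsection.
  by apply: eq_integral => t _; rewrite !indicE mem_xsection.
have As : 0 <= s -> xsection A s =
    [set t | 0 <= t /\ (s%:E < mu [set x | (t < f x)%R])%E].
  move=> s0; apply/seteqP; split=> t; rewrite /xsection /A /b /= inE /= s0 /=.
    by move=> /andP[t0]; rewrite -lte_fin EG ccdfE.
  by move=> [t0]; rewrite -ccdfE// -EG lte_fin t0.
rewrite patchE; case: ifPn; rewrite ?notin_setE ?inE /= in_itv/=.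
  move=> /andP[s0 s1]; rewrite As// lebesgue_measure_initial_segment//.
  - by move=> t [].
  - move=> t u [t0 st] /andP[u0 ut]; split=> //; apply: lt_le_trans st _.
    apply: le_measure; rewrite ?inE; [exact: measurable_gt|exact: measurable_gt|].
    by move=> x /=; exact: le_lt_trans.
  - exact: has_ubound_rearrangement.
move=> /negP; rewrite negb_and -!ltNge => /orP[s0|s1].
  rewrite (_ : xsection A s = set0) ?measure0//.
  by rewrite -subset0 => t; rewrite /xsection /A /b /= inE /= (leNgt 0 s) s0.
rewrite As ?(le_trans ler01 (ltW s1))// (_ : [set _ | _] = set0) ?measure0//.
rewrite -subset0 => t [_]; apply/negP; rewrite -leNgt.
apply: (@le_trans _ _ 1%E); last by rewrite lee_fin ltW.
by apply: probability_le1; exact: measurable_gt.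
Qed.

(** * Integrals of truncations and the truncation level *)

Lemma Linfty_pos_integrable f : Linfty_pos mu f -> mu.-integrable setT (EFin \o f).
Proof.
case=> Lf _; apply/Lfun1_integrable.
have muT : mu setT \is a fin_num by rewrite probability_setT.
by apply: (Lfun_subset (lexx 1%E) (leey 1%E) muT (leey 1%E)).
Qed.

Lemma Rintegral_probability_cst r : \int[mu]_x cst r x = r.
Proof.
rewrite Rintegral_cst//; have -> : fine (mu setT) = 1 by rewrite probability_setT.
by rewrite mulr1.
Qed.

(** The map is 1-Lipschitz: [max(y, c)] is 1-Lipschitz in [c], and the total mass is 1. *)
Lemma continuous_integral_max f : Linfty_pos mu f ->
  continuous (fun c => \int[mu]_x (f \max cst c) x).
Proof.
move=> Lf; set I := fun _ => _.
have intI a : mu.-integrable setT (EFin \o (f \max cst a)).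
  exact/Linfty_pos_integrable/Linfty_pos_max.
have intc r : mu.-integrable setT (EFin \o cst r).
  exact: finite_measure_integrable_cst.
have leI a b : I a <= I b + `|a - b|.
  have -> : I b + `|a - b| = \int[mu]_x ((f \max cst b) x + cst `|a - b| x).
    by rewrite RintegralD// Rintegral_probability_cst.
  apply: le_Rintegral => //; first exact: integrableD (intI b) (intc _).
  move=> x _ /=.
  have fm : f x <= Num.max (f x) b by rewrite le_max lexx.
  have bm : b <= Num.max (f x) b by rewrite le_max lexx orbT.
  have := normr_ge0 (a - b); have := ler_norm (a - b).
  by rewrite ge_max => *; apply/andP; split; lra.
move=> c; apply/cvgrPdist_le => e e0.
have : \forall b \near c, `|b - c| <= e.
  exact: (@cvgr_distC_le _ _ _ _ (nbhs_filter c) id c cvg_id).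
apply: filterS => b.
have := leI b c; have := leI c b; rewrite (distrC c b).
move: (I c) (I b) (`|b - c|) => u v k uv vu ke.
by rewrite ler_norml; apply/andP; split; lra.
Qed.

(** Existence is the intermediate value theorem between the essential infimum [r] and [w];
    uniqueness is strict monotonicity of [I] from [r] on. *)
Lemma exists_unique_truncation_level f w : Linfty_pos mu f ->
  (\int[mu]_x (f x)%:E <= w%:E)%E -> exists c, unique (truncation_level mu f w) c.
Proof.
move=> Lf fw; have /Linfty_posP[mf [M fM] f0] := Lf.
pose I c := \int[mu]_x (f \max cst c) x.
have intI a : mu.-integrable setT (EFin \o (f \max cst a)).
  exact/Linfty_pos_integrable/Linfty_pos_max.
have intE c : (\int[mu]_x ((f \max cst c) x)%:E = (I c)%:E)%E.
  by rewrite /I /Rintegral fineK//; exact: (integrable_fin_num _ (intI c)).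
pose m := ess_inf mu (EFin \o f).
have mu_gt0 : (0 < mu setT)%E by rewrite probability_setT lte01.
have : m \is a fin_num.
  rewrite ge0_fin_numE; last by rewrite /m; apply/ess_infP; apply: filterS f0.
  apply: (@le_lt_trans _ _ M%:E); last exact: ltry.
  rewrite -(ess_inf_cst M%:E mu_gt0).
  by apply: le_ess_inf; apply: filterS fM.
move=> /fineK mE; set r := fine m in mE.
have fr : \forall x \ae mu, r <= f x.
  by apply: filterS (ess_inf_le mu (EFin \o f)) => x /=; rewrite -/m -mE.
have Irw : I r <= w.
  rewrite -lee_fin -intE (le_trans _ fw)// (@ae_eq_integral _ _ _ _ _ (EFin \o f))//.
  - by case/integrableP: (intI r).
  - exact/measurable_EFinP.
  - by apply: filterS fr => x rfx _ /=; rewrite max_l.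
(* This provides both [r <= w] and the right endpoint [w] of the interval, since [w <= I w]. *)
have leI c : c <= I c.
  rewrite -[leLHS]Rintegral_probability_cst.
  apply: le_Rintegral => //; first exact: finite_measure_integrable_cst.
  by move=> x _ /=; rewrite le_max lexx orbT.
have rw : r <= w by exact: le_trans (leI r) Irw.
have [|c] := @IVT R I r w w rw (continuous_subspaceT (continuous_integral_max Lf)).
  by rewrite ge_min Irw le_max (leI w) orbT.
rewrite in_itv/= => /andP[rc _] Ic.
exists c; split.
  by split; [rewrite -/m -mE lee_fin|rewrite intE Ic].
(* Otherwise the nonnegative difference of the truncations has integral 0 and vanishes a.e. Where
   [f < b] it is positive, so [f >= b] a.e., against [b > r]. *)
have ltI a b : r <= a -> a < b -> I a < I b.
  move=> ra ab; rewrite ltNge; apply/negP => ba.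
  have ge0 x : 0 <= (f \max cst b) x - (f \max cst a) x.
    by rewrite subr_ge0 /= ge_max !le_max lexx (ltW ab) orbT.
  have : ae_eq mu setT (fun x => ((f \max cst b) x - (f \max cst a) x)%:E) (cst 0%E).
    apply/ae_eq_integral_abs => //.
      by apply/measurable_EFinP; apply: measurable_funB; exact: measurable_maxr.
    apply/eqP; rewrite eq_le integral_ge0// andbT.
    under eq_integral do rewrite gee0_abs ?lee_fin//.
    by rewrite integralB_EFin// !intE -EFinB lee_fin subr_le0.
  move=> ab0; have : (b%:E <= m)%E.
    rewrite /m; apply/ess_infP; apply: filterS ab0 => x /(_ Logic.I) /= [].
    rewrite lee_fin leNgt => E; apply/negP => fb; move: E.
    rewrite [Num.max _ b]max_r ?(ltW fb)// => /subr0_eq ba'.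
    have : Num.max (f x) a < b by rewrite gt_max fb.
    by rewrite -ba' ltxx.
  by rewrite -mE lee_fin leNgt (le_lt_trans ra).
move=> b [mb]; rewrite intE => -[wb].
have {}mb : r <= b by rewrite -lee_fin mE.
apply/eqP; rewrite eq_le !leNgt; apply/andP; split; apply/negP => cb.
- by have := ltI _ _ mb cb; rewrite wb Ic ltxx.
- by have := ltI _ _ rc cb; rewrite wb Ic ltxx.
Qed.

(** * Comparison of the partial integrals of the rearrangements *)

Lemma submajorizes_max f h c : Linfty_pos mu f -> Linfty_pos mu h -> 0 <= c ->
  (\forall x \ae mu, f x <= h x) ->
  (\int[mu]_x ((f \max cst c) x)%:E <= \int[mu]_x (h x)%:E)%E ->
  submajorizes mu h (f \max cst c).
Proof.
move=> Lf Lh c0 fh intfh s /andP[s0 s1].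
have Lc := Linfty_pos_max c Lf.
have mR g (a b : itv_bound R) : Linfty_pos mu g -> (BLeft 0 <= a)%O ->
    measurable_fun [set` Interval a b] (EFin \o g^#).
  move=> Lg a0; apply/measurable_EFinP; apply: measurable_rearrangement => //.
  move=> t /= /andP[/(le_trans a0)].
  by rewrite bnd_simp.
have [ch|hc] := leP c (h^# s).
  apply: ge0_le_integral => //=.
  - by move=> t _; rewrite lee_fin rearrangement_ge0.
  - exact: mR.
  - exact: mR.
  - move=> t; rewrite in_itv/= lee_fin => /andP[t0 ts].
    (* The point [t = 1] occurs when [s = 1]; there the left-hand rearrangement is 0. *)
    have [t1|t1] := leP 1 t.
      rewrite [leLHS]rearrangement_ge1 ?rearrangement_ge0//.
      by have /Linfty_posP[] := Lc.
    rewrite rearrangement_max ?t0// ge_max le_rearrangement//=.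
    by rewrite (le_trans ch)// rearrangement_nonincreasing.
have split_ g : Linfty_pos mu g -> (\int[mu]_x (g x)%:E =
    \int[lebesgue_measure]_(t in `[0%R, s]) (g^# t)%:E +
    \int[lebesgue_measure]_(t in `]s, 1%R]) (g^# t)%:E)%E.
  move=> Lg; rewrite -integral_rearrangement//.
  have E : `[0, 1]%classic = `[0, s] `|` `]s, 1] :> set R.
    by rewrite -itv_bndbnd_setU//= bnd_simp.
  rewrite E ge0_integral_setU//=.
  - by rewrite -E; exact: mR.
  - by move=> t _; rewrite lee_fin rearrangement_ge0.
  - apply/disj_setPS => t [] /=; rewrite !in_itv/= => /andP[_ ts] /andP[].
    by rewrite ltNge ts.
move: intfh; rewrite !split_//.
have tail_le : (\int[lebesgue_measure]_(t in `]s, 1%R]) (h^# t)%:E <=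
  \int[lebesgue_measure]_(t in `]s, 1%R]) ((f \max cst c)^# t)%:E)%E.
  apply: ge0_le_integral => //=.
  - by move=> t _; rewrite lee_fin rearrangement_ge0.
  - by apply: mR => //; rewrite bnd_simp.
  - by apply: mR => //; rewrite bnd_simp.
  - move=> t; rewrite in_itv/= lee_fin => /andP[st t1].
    have [tge1|tlt1] := leP 1 t.
      rewrite rearrangement_ge1 ?rearrangement_ge0//.
      by have /Linfty_posP[] := Lh.
    rewrite rearrangement_max ?(ltW (le_lt_trans s0 st))// le_max; apply/orP; right.
    by rewrite (le_trans _ (ltW hc))// rearrangement_nonincreasing// ltW.
(* Finiteness of the tail is what permits cancelling it in the extended reals. *)
have tail_fin : (\int[lebesgue_measure]_(t in `]s, 1%R])
    ((f \max cst c)^# t)%:E)%E \is a fin_num.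
  have := integrable_fin_num measurableT (Linfty_pos_integrable Lc).
  by rewrite /= split_// fin_numD => /andP[].
move=> le_int; rewrite -(@leeD2rE _ _ _ _ tail_fin).
exact: le_trans le_int (leeD2l _ tail_le).
Qed.

End rearrangement.

Theorem theorem5p5 (d : measure_display) (X : measurableType d) (R : realType)
    (mu : probability X R) (f : X -> R) (w : R)
    (hf : Linfty_pos mu f)
    (hw : (\int[mu]_x (f x)%:E <= w%:E)%E) :
  exists c : R, unique (truncation_level mu f w) c /\
    forall h : X -> R, Linfty_pos mu h ->
      (\forall x \ae mu, f x <= h x) ->
      (w%:E <= \int[mu]_x (h x)%:E)%E ->
      submajorizes mu h (f \max cst c).
Proof.
have [c cP] := exists_unique_truncation_level hf hw.
exists c; split=> // h hh fh wh; have [[mc wc] _] := cP.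
apply: submajorizes_max; rewrite ?wc//.
(* [c] is nonnegative because it is at least the essential infimum of [f], which is itself
   nonnegative. *)
rewrite -lee_fin (le_trans _ mc)//; apply/ess_infP.
by case: hf => _; apply: filterS.
Qed.
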